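(* Let $q\in(0,1)$ and let $\alpha$ be a real number. The function $x\mapsto [f_{\alpha,1}(x;q)]^{-1}$ is logarithmically completely monotonic on $(0,\infty)$ if and only if $\alpha\ge 1$.
   Context: Here $q\in(0,1)$ is a fixed parameter. For $x>0$, the $q$-gamma function is $\Gamma_q(x)=(1-q)^{1-x}\prod_{j=0}^{\infty}\frac{1-q^{j+1}}{1-q^{j+x}}$. The dilogarithm is $\mathrm{Li}_2(z)=-\int_0^z\frac{\log(1-t)}{t}\,dt$ for $0<z<1$. For real $\alpha$, define $$f_{\alpha,1}(x;q)=\frac{\Gamma_q(x+1)\exp\left(-\frac{\mathrm{Li}_2(1-q^x)}{\log q}\right)}{\left(\frac{1-q^x}{1-q}\right)^{x+1-\alpha}},\qquad x>0,$$ and $[f_{\alpha,1}(x;q)]^{-1}=1/f_{\alpha,1}(x;q)$ denotes its reciprocal. A positive function $f$ on an interval $I$ is logarithmically completely monotonic on $I$ if $\log f$ has derivatives of all orders and $(-1)^n(\log f)^{(n)}(x)\ge 0$ for all $x\in I$ and all integers $n\ge 1$. *)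

(* Defs.v *)
From Stdlib Require Import Reals.
From Coquelicot Require Import Coquelicot.
Open Scope R_scope.

Definition q_gamma (q x : R) : R :=
  Rpower (1 - q) (1 - x) *
  real (Lim_seq (fun n =>
    prod_f_R0 (fun j => (1 - q ^ (j + 1)) / (1 - Rpower q (INR j + x))) n)).

(* For 0 < z < 1.  The singularity of the integrand at t = 0 is removable, so
   the total value ln 1 / 0 used there does not affect the Riemann integral. *)
Definition Li2 (z : R) : R := - RInt (fun t => ln (1 - t) / t) 0 z.

Definition f_alpha1 (q alpha x : R) : R :=
  q_gamma q (x + 1) * exp (- (Li2 (1 - Rpower q x) / ln q)) /
  Rpower ((1 - Rpower q x) / (1 - q)) (x + 1 - alpha).

(* Logarithmic complete monotonicity on the open interval (a, b); openness is
   what makes the two-sided derivatives of Coquelicot the right ones. *)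
Definition log_completely_monotonic (a b : Rbar) (f : R -> R) : Prop :=
  let g := fun x => ln (f x) in
  forall x : R, Rbar_lt a x -> Rbar_lt x b ->
    0 < f x /\
    (forall n : nat, ex_derive_n g n x) /\
    (forall n : nat, (1 <= n)%nat -> 0 <= (-1) ^ n * Derive_n g n x).

(* Main.v *)
Require Import Defs.
From Stdlib Require Import Reals Lra Lia.
From Coquelicot Require Import Coquelicot.
Open Scope R_scope.

(** Put y = q^x, so that x in (0,oo) corresponds to y in (0,1), and write
    g = ln (1 / f_{alpha,1}).  Differentiating the dilogarithm term cancels the
    part of the derivative that is proportional to x, and what remains is
    - g'(x) = - ln (1 - y) + ln q * sum_{j>=1} q^j y / (1 - q^j y)
              - (alpha - 1) * ln q * y / (1 - y).
    Expanding in powers of y gives - g'(x) = sum_{k>=1} c_k q^{kx} with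
    c_k = 1/k + ln q * q^k / (1 - q^k) - (alpha - 1) * ln q.

    If alpha >= 1, all c_k are nonnegative: with u = - k ln q the first two
    terms are (1/k) (1 - u / (e^u - 1)), and 1 + u <= e^u.  Each further
    derivative multiplies the k-th term by k ln q, whose sign is constant, so
    (-1)^n g^(n) >= 0 for all n >= 1.  On power series in y this operation is
    ln q times the Euler operator y d/dy, called [theta] on coefficients;
    the derivatives of g are [is_derive_n_ln_inv_f_alpha1] and the sign of the
    coefficients is [dirichlet_coef_nonneg].

    If alpha < 1, already the first derivative has the wrong sign near x = 0:
    there the pole (1 - alpha) * (- ln q) * y / (1 - y) of g' beats the
    logarithm ln (1 - y) ([ln_plus_pole_pos]), while the remaining terms of g'
    are nonnegative.

    The expansion of the q-gamma function needs no interchange of summations: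
    the series P(y) = sum_{k>=1} q^k y^k / (k (1 - q^k)) satisfies
    P(y) - P(q y) = - ln (1 - q y) ([gamma_series_q_difference]), so the
    partial products telescope ([q_gamma_partial_product]), and letting the
    number of factors grow gives
    Gamma_q(x+1) = (1 - q)^{-x} exp (P(q^x) - P(1)) ([q_gamma_eq]). *)

(** * Power series in q^x and the Euler operator *)

Lemma is_derive_eq (f : R -> R) (x l l' : R) :
  is_derive f x l -> l = l' -> is_derive f x l'.
Proof. now intros H <-. Qed.

Lemma CV_radius_gt_of_bounded (a : nat -> R) (r M y : R) :
  (forall n, Rabs (a n * r ^ n) <= M) -> Rabs y < r ->
  Rbar_lt (Rabs y) (CV_radius a).
Proof.
  intros Hb Hy.
  apply Rbar_lt_le_trans with (Finite r); [exact Hy|].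
  destruct (CV_radius_bounded a) as [Hub _].
  apply Hub. now exists M.
Qed.

(** The Euler operator y d/dy, acting on the coefficients of a power series. *)
Definition theta (a : nat -> R) (k : nat) : R := INR k * a k.

Lemma theta_PS_derive (a : nat -> R) (k : nat) :
  theta a k = PS_incr_1 (PS_derive a) k.
Proof.
  destruct k as [|k]; unfold theta, PS_derive; simpl PS_incr_1; [|reflexivity].
  simpl. unfold zero; simpl. ring.
Qed.

Lemma CV_radius_theta (a : nat -> R) : CV_radius (theta a) = CV_radius a.
Proof.
  rewrite (CV_radius_ext _ _ (theta_PS_derive a)).
  now rewrite CV_radius_incr_1, CV_radius_derive.
Qed.

Lemma CV_radius_theta_iter (a : nat -> R) (n : nat) :
  CV_radius (Nat.iter n theta a) = CV_radius a.
Proof.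
  induction n as [|n IH]; [reflexivity|].
  simpl. now rewrite CV_radius_theta.
Qed.

Lemma PSeries_theta (a : nat -> R) (y : R) :
  PSeries (theta a) y = y * PSeries (PS_derive a) y.
Proof.
  rewrite (PSeries_ext _ _ _ (theta_PS_derive a)).
  apply (PSeries_incr_1 (PS_derive a)).
Qed.

Lemma theta_iter_nonneg (a : nat -> R) (n : nat) :
  (forall k, 0 <= a k) -> forall k, 0 <= Nat.iter n theta a k.
Proof.
  intros Ha. induction n as [|n IH]; intros k; [apply Ha|].
  simpl. apply Rmult_le_pos; [apply pos_INR | apply IH].
Qed.

Lemma PSeries_nonneg (a : nat -> R) (y : R) :
  (forall k, 0 <= a k) -> 0 <= y -> Rbar_lt (Rabs y) (CV_radius a) ->
  0 <= PSeries a y.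
Proof.
  intros Ha Hy Hr.
  rewrite <- (PSeries_const_0 y). apply Series_le.
  - intros k. rewrite Rmult_0_l. split; [lra|].
    apply Rmult_le_pos; [apply Ha | now apply pow_le].
  - apply ex_series_Rabs, CV_disk_inside, Hr.
Qed.

Lemma is_derive_Rpower_base (q x : R) :
  is_derive (fun x => Rpower q x) x (ln q * Rpower q x).
Proof.
  unfold Rpower. auto_derive; [exact I | ring].
Qed.

(** With y = q^x one has d/dx = ln q * y d/dy, so the class of power series in
    q^x is stable under differentiation; this is what makes derivatives of all
    orders accessible by induction. *)
Lemma is_derive_PSeries_Rpower (a : nat -> R) (q x : R) :
  Rbar_lt (Rpower q x) (CV_radius a) ->
  is_derive (fun x => PSeries a (Rpower q x)) x
    (ln q * PSeries (theta a) (Rpower q x)).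
Proof.
  intros Hr.
  assert (Hp : 0 < Rpower q x) by apply exp_pos.
  assert (D1 : is_derive (PSeries a) (Rpower q x)
                 (PSeries (PS_derive a) (Rpower q x))).
  { apply is_derive_PSeries. rewrite Rabs_pos_eq by lra. exact Hr. }
  refine (is_derive_eq _ _ _ _
    (is_derive_comp _ _ x _ _ D1 (is_derive_Rpower_base q x)) _).
  unfold scal; simpl; unfold mult; simpl.
  rewrite PSeries_theta. ring.
Qed.

Lemma Rpower_lt_1 (q x : R) : 0 < q < 1 -> 0 < x -> 0 < Rpower q x < 1.
Proof.
  intros Hq Hx. split; [apply exp_pos|].
  unfold Rpower. rewrite <- exp_0. apply exp_increasing.
  assert (ln q < 0) by (rewrite <- ln_1; apply ln_increasing; lra). nra.
Qed.

(** * The logarithm and the dilogarithm *)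

(** The coefficients of - ln (1 - y).  The convention / 0 = 0 makes the constant
    coefficient vanish, as it should. *)
Definition log_coef (k : nat) : R := / INR k.

Lemma log_coef_bounds (k : nat) : 0 <= log_coef k <= 1.
Proof.
  unfold log_coef. destruct k as [|k].
  - simpl. rewrite Rinv_0. lra.
  - assert (H : 1 <= INR (S k)) by (rewrite S_INR; pose proof (pos_INR k); lra).
    split; [apply Rlt_le, Rinv_0_lt_compat; lra|].
    rewrite <- Rinv_1. apply Rinv_le_contravar; lra.
Qed.

Lemma CV_radius_log_coef (y : R) :
  Rabs y < 1 -> Rbar_lt (Rabs y) (CV_radius log_coef).
Proof.
  apply CV_radius_gt_of_bounded with (M := 1).
  intros n. rewrite pow1, Rmult_1_r.
  pose proof (log_coef_bounds n). rewrite Rabs_pos_eq; lra.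
Qed.

Lemma PSeries_derive_log_coef (y : R) :
  Rabs y < 1 -> PSeries (PS_derive log_coef) y = / (1 - y).
Proof.
  intros Hy. rewrite <- Series_geom by exact Hy.
  apply Series_ext. intros n. unfold PS_derive, log_coef.
  rewrite Rinv_r by (apply not_0_INR; lia). ring.
Qed.

(** Both sides have derivative 1 / (1 - y) and vanish at 0. *)
Lemma PSeries_log_coef (y : R) :
  Rabs y < 1 -> PSeries log_coef y = - ln (1 - y).
Proof.
  intros Hy.
  set (F := fun t => PSeries log_coef t + ln (1 - t)).
  assert (D : forall t, Rabs t < 1 -> is_derive F t 0).
  { intros t Ht. pose proof (Rabs_def2 _ _ Ht).
    assert (D1 := is_derive_PSeries _ _ (CV_radius_log_coef t Ht)).
    rewrite PSeries_derive_log_coef in D1 by exact Ht.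
    assert (D2 : is_derive (fun t => ln (1 - t)) t (- / (1 - t))).
    { auto_derive; [lra | field; lra]. }
    refine (is_derive_eq _ _ _ _ (is_derive_plus _ _ _ _ _ D1 D2) _).
    unfold plus; simpl. ring. }
  assert (F0 : F 0 = 0).
  { unfold F. rewrite PSeries_0, Rminus_0_r, ln_1.
    unfold log_coef. simpl. rewrite Rinv_0. ring. }
  assert (Hin : forall t, Rmin 0 y <= t <= Rmax 0 y -> Rabs t < 1).
  { intros t. apply Rabs_def2 in Hy.
    unfold Rmin, Rmax; destruct (Rle_dec 0 y); intros; apply Rabs_def1; lra. }
  destruct (MVT_gen F 0 y (fun _ => 0)) as [c [_ Hc]].
  - intros t Ht. apply D, Hin. lra.
  - intros t Ht. apply continuity_pt_filterlim.
    apply (@ex_derive_continuous R_AbsRing R_NormedModule). exists 0. apply D, Hin, Ht.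
  - rewrite F0 in Hc. unfold F in Hc. lra.
Qed.

Lemma PSeries_theta_log_coef (y : R) :
  Rabs y < 1 -> PSeries (theta log_coef) y = y / (1 - y).
Proof.
  intros Hy. rewrite PSeries_theta, PSeries_derive_log_coef by exact Hy.
  reflexivity.
Qed.

(** The integrand coincides on (0,1) with a power series, which is continuous
    on the closed interval; this gives integrability up to the removable
    singularity at 0, and then the fundamental theorem of calculus applies. *)
Lemma is_derive_Li2 (z : R) :
  0 < z < 1 -> is_derive Li2 z (- (ln (1 - z) / z)).
Proof.
  intros Hz.
  assert (Hext : forall t, 0 < t < 1 ->
            - PSeries (PS_decr_1 log_coef) t = ln (1 - t) / t).
  { intros t Ht.
    assert (Ha : Rabs t < 1) by (rewrite Rabs_pos_eq; lra).
    assert (E := PSeries_decr_1 log_coef t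
                   (CV_radius_inside _ _ (CV_radius_log_coef t Ha))).
    rewrite PSeries_log_coef in E by exact Ha.
    unfold log_coef at 1 in E. simpl in E. rewrite Rinv_0 in E.
    replace (ln (1 - t)) with (- (t * PSeries (PS_decr_1 log_coef) t)) by lra.
    field. lra. }
  assert (D : is_derive (fun z => RInt (fun t => ln (1 - t) / t) 0 z) z
                (ln (1 - z) / z)).
  { apply (is_derive_RInt (fun t => ln (1 - t) / t) _ 0).
    - apply (locally_interval _ z 0 1); simpl; try lra.
      intros w Hw0 Hw1. apply (@RInt_correct R_CompleteNormedModule).
      apply ex_RInt_ext with (fun t => - PSeries (PS_decr_1 log_coef) t).
      + intros t. rewrite Rmin_left, Rmax_right by lra.
        intros Ht. apply Hext. lra.
      + apply (@ex_RInt_continuous R_CompleteNormedModule).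
        intros t. rewrite Rmin_left, Rmax_right by lra. intros Ht.
        apply (@continuous_opp _ R_AbsRing R_NormedModule).
        apply continuity_pt_filterlim, PSeries_continuity.
        rewrite CV_radius_decr_1. apply CV_radius_log_coef.
        rewrite Rabs_pos_eq; lra.
    - apply (@ex_derive_continuous R_AbsRing R_NormedModule).
      auto_derive. lra. }
  exact (is_derive_opp _ _ _ D).
Qed.

Lemma is_derive_Li2_Rpower (q x : R) :
  0 < q < 1 -> 0 < x ->
  is_derive (fun x => Li2 (1 - Rpower q x)) x
    (x * ln q ^ 2 * (Rpower q x / (1 - Rpower q x))).
Proof.
  intros Hq Hx. pose proof (Rpower_lt_1 q x Hq Hx) as Hp.
  assert (D1 : is_derive (fun x => 1 - Rpower q x) x (- (ln q * Rpower q x))).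
  { refine (is_derive_eq _ _ _ _ (is_derive_minus _ _ x _ _ (is_derive_const 1 x)
                  (is_derive_Rpower_base q x)) _).
    unfold minus, plus, opp, zero; simpl. ring. }
  assert (D2 := is_derive_Li2 (1 - Rpower q x) ltac:(lra)).
  refine (is_derive_eq _ _ _ _ (is_derive_comp _ _ x _ _ D2 D1) _).
  unfold scal; simpl; unfold mult; simpl.
  replace (1 - (1 - Rpower q x)) with (Rpower q x) by ring.
  rewrite ln_Rpower. field. lra.
Qed.

(** * The q-gamma function as a power series in q^x *)

(** The coefficients of P(y) = - sum_{j>=1} ln (1 - q^j y), expanded in powers
    of y and summed over j as a geometric series. *)
Definition gamma_coef (q : R) (k : nat) : R := log_coef k * (q ^ k / (1 - q ^ k)).

Lemma pow_S_bounds (q : R) (k : nat) : 0 < q < 1 -> 0 < q ^ S k <= q.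
Proof.
  intros Hq. split; [apply pow_lt; lra|].
  pose proof (pow_lt q k ltac:(lra)).
  assert (q ^ k <= 1) by (rewrite <- (pow1 k); apply pow_incr; lra).
  simpl. nra.
Qed.

Lemma gamma_coef_nonneg (q : R) (k : nat) : 0 < q < 1 -> 0 <= gamma_coef q k.
Proof.
  intros Hq. unfold gamma_coef. destruct k as [|k].
  - unfold log_coef. simpl INR. rewrite Rinv_0. lra.
  - pose proof (pow_S_bounds q k Hq). pose proof (log_coef_bounds (S k)).
    apply Rmult_le_pos; [lra|].
    apply Rlt_le, Rdiv_lt_0_compat; lra.
Qed.

(** The radius exceeds 1, so that the value at y = 1, which is the contribution
    of the numerators of the q-gamma product, lies inside the disk. *)
Lemma CV_radius_gamma_coef (q y : R) :
  0 < q < 1 -> Rabs y < / q -> Rbar_lt (Rabs y) (CV_radius (gamma_coef q)).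
Proof.
  intros Hq. apply CV_radius_gt_of_bounded with (M := / (1 - q)).
  assert (Hi : 0 < / (1 - q)) by (apply Rinv_0_lt_compat; lra).
  intros [|k].
  - unfold gamma_coef, log_coef. simpl INR. rewrite Rinv_0, !Rmult_0_l, Rabs_R0.
    lra.
  - pose proof (pow_S_bounds q k Hq). pose proof (log_coef_bounds (S k)).
    replace (gamma_coef q (S k) * (/ q) ^ S k)
      with (log_coef (S k) * / (1 - q ^ S k)).
    + assert (0 < / (1 - q ^ S k) <= / (1 - q)).
      { split; [apply Rinv_0_lt_compat | apply Rinv_le_contravar]; lra. }
      rewrite Rabs_pos_eq; nra.
    + unfold gamma_coef. rewrite pow_inv. field. lra.
Qed.

(** The factor 1 - q^k produced by y -> q y cancels the denominator of the
    coefficients and leaves the logarithmic series at q y. *)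
Lemma gamma_series_q_difference (q y : R) :
  0 < q < 1 -> 0 <= y <= 1 ->
  PSeries (gamma_coef q) y - PSeries (gamma_coef q) (q * y) = - ln (1 - q * y).
Proof.
  intros Hq Hy.
  assert (H1 : 1 < / q) by (rewrite <- Rinv_1; apply Rinv_lt_contravar; lra).
  rewrite <- PSeries_log_coef by (rewrite Rabs_pos_eq; nra).
  unfold PSeries.
  rewrite <- Series_minus.
  - apply Series_ext. intros [|k].
    + unfold gamma_coef, log_coef. simpl INR. rewrite Rinv_0. ring.
    + pose proof (pow_S_bounds q k Hq). rewrite Rpow_mult_distr.
      unfold gamma_coef. field. lra.
  - apply ex_series_Rabs, CV_disk_inside, CV_radius_gamma_coef; [exact Hq|].
    rewrite Rabs_pos_eq; lra.
  - apply ex_series_Rabs, CV_disk_inside, CV_radius_gamma_coef; [exact Hq|].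
    rewrite Rabs_pos_eq; nra.
Qed.

(** By the q-difference equation, the logarithm of each factor is a difference
    of consecutive values of P along y, q y, q^2 y, ... (with y = q^x for the
    denominator and y = 1 for the numerator), so the product telescopes. *)
Lemma q_gamma_partial_product (q x : R) (n : nat) :
  0 < q < 1 -> 0 < x ->
  prod_f_R0 (fun j => (1 - q ^ (j + 1)) / (1 - Rpower q (INR j + (x + 1)))) n =
  exp (PSeries (gamma_coef q) (Rpower q x)
       - PSeries (gamma_coef q) (q ^ S n * Rpower q x)
       - (PSeries (gamma_coef q) 1 - PSeries (gamma_coef q) (q ^ S n))).
Proof.
  intros Hq Hx. pose proof (Rpower_lt_1 q x Hq Hx) as Hp.
  set (P := PSeries (gamma_coef q)). set (t := Rpower q x) in *.
  assert (Hfac : forall j,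
    (1 - q ^ (j + 1)) / (1 - Rpower q (INR j + (x + 1))) =
    exp ((P (q ^ j * t) - P (q ^ S j * t)) - (P (q ^ j) - P (q ^ S j)))).
  { intros j.
    replace (Rpower q (INR j + (x + 1))) with (q ^ S j * t).
    2: { replace (INR j + (x + 1)) with (INR (S j) + x)
           by (rewrite S_INR; ring).
         rewrite Rpower_plus, Rpower_pow by lra. reflexivity. }
    replace (j + 1)%nat with (S j) by lia.
    assert (Hj : 0 < q ^ j <= 1).
    { split; [apply pow_lt; lra|]. rewrite <- (pow1 j). apply pow_incr; lra. }
    assert (Hfe : forall y, 0 <= y <= 1 ->
              exp (P y - P (q * y)) = / (1 - q * y)).
    { intros y Hy. unfold P. rewrite gamma_series_q_difference by assumption.
      rewrite exp_Ropp, exp_ln by nra. reflexivity. }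
    unfold Rminus at 3. rewrite exp_plus, exp_Ropp.
    simpl pow. rewrite !Rmult_assoc, !Hfe by nra.
    rewrite Rinv_inv. unfold Rdiv. ring. }
  induction n as [|n IH].
  - cbn [prod_f_R0]. rewrite Hfac. f_equal. simpl pow.
    rewrite Rmult_1_l. ring.
  - cbn [prod_f_R0]. rewrite IH, Hfac, <- exp_plus. f_equal. ring.
Qed.

Lemma q_gamma_eq (q x : R) :
  0 < q < 1 -> 0 < x ->
  q_gamma q (x + 1) =
  exp (- x * ln (1 - q)
       + (PSeries (gamma_coef q) (Rpower q x) - PSeries (gamma_coef q) 1)).
Proof.
  intros Hq Hx. unfold q_gamma.
  rewrite exp_plus. f_equal.
  { unfold Rpower. f_equal. ring. }
  set (P := PSeries (gamma_coef q)).
  assert (HP0 : continuity_pt P 0).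
  { apply PSeries_continuity, CV_radius_gamma_coef; [exact Hq|].
    rewrite Rabs_R0. apply Rinv_0_lt_compat; lra. }
  assert (Hpow : is_lim_seq (fun n => q ^ S n) 0).
  { apply (is_lim_seq_incr_1 (fun n => q ^ n)), is_lim_seq_geom.
    rewrite Rabs_pos_eq; lra. }
  assert (Hlim : is_lim_seq
    (fun n => exp (P (Rpower q x) - P (q ^ S n * Rpower q x) - (P 1 - P (q ^ S n))))
    (exp (P (Rpower q x) - P 0 - (P 1 - P 0)))).
  { apply is_lim_seq_continuous.
    { apply derivable_continuous_pt, derivable_pt_exp. }
    apply is_lim_seq_minus'; apply is_lim_seq_minus';
      try apply is_lim_seq_const; apply is_lim_seq_continuous; try exact HP0.
    - replace (Finite 0) with (Rbar_mult 0 (Rpower q x)) by (simpl; f_equal; ring).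
      apply (is_lim_seq_scal_r _ _ _ Hpow).
    - exact Hpow. }
  erewrite Lim_seq_ext.
  2: { intros n. apply (q_gamma_partial_product q x n Hq Hx). }
  fold P.
  rewrite (is_lim_seq_unique _ _ Hlim). simpl. f_equal. ring.
Qed.

(** * The logarithm of 1 / f and its derivatives *)

Lemma f_alpha1_pos (q alpha x : R) :
  0 < q < 1 -> 0 < x -> 0 < f_alpha1 q alpha x.
Proof.
  intros Hq Hx. unfold f_alpha1. rewrite q_gamma_eq by assumption.
  apply Rdiv_lt_0_compat; [apply Rmult_lt_0_compat|]; apply exp_pos.
Qed.

Lemma ln_inv_f_alpha1 (q alpha x : R) :
  0 < q < 1 -> 0 < x ->
  ln (/ f_alpha1 q alpha x) =
  x * ln (1 - q) - (PSeries (gamma_coef q) (Rpower q x) - PSeries (gamma_coef q) 1)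
  + Li2 (1 - Rpower q x) / ln q
  + (x + 1 - alpha) * (ln (1 - Rpower q x) - ln (1 - q)).
Proof.
  intros Hq Hx. pose proof (Rpower_lt_1 q x Hq Hx) as Hp.
  rewrite ln_Rinv by now apply f_alpha1_pos.
  unfold f_alpha1. rewrite q_gamma_eq by assumption.
  rewrite ln_div, ln_mult, !ln_exp, ln_Rpower, ln_div
    by (lra || apply exp_pos || (apply Rmult_lt_0_compat; apply exp_pos)).
  field. rewrite <- ln_1. intros E. apply ln_inv in E; lra.
Qed.

(** The coefficients a_k for which g and (- 1 / ln q) * sum_k a_k q^{kx} have the
    same derivative.  Thus [theta] of it gives the coefficients c_k of - g', and
    its constant coefficient is 0 because [log_coef 0] is. *)
Definition dirichlet_coef (q alpha : R) (k : nat) : R :=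
  log_coef k * log_coef k + ln q * gamma_coef q k - ln q * (alpha - 1) * log_coef k.

Lemma CV_radius_dirichlet_coef (q alpha y : R) :
  0 < q < 1 -> Rabs y < 1 -> Rbar_lt (Rabs y) (CV_radius (dirichlet_coef q alpha)).
Proof.
  intros Hq.
  apply CV_radius_gt_of_bounded
    with (M := 1 + Rabs (ln q) * / (1 - q) + Rabs (ln q * (alpha - 1))).
  intros k. rewrite pow1, Rmult_1_r.
  pose proof (log_coef_bounds k) as Hl.
  assert (Hi : 1 <= / (1 - q)).
  { rewrite <- Rinv_1. apply Rinv_le_contravar; lra. }
  assert (Hg : 0 <= gamma_coef q k <= / (1 - q)).
  { split; [now apply gamma_coef_nonneg|].
    destruct k as [|k].
    - unfold gamma_coef, log_coef. simpl INR. rewrite Rinv_0, Rmult_0_l. lra.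
    - unfold gamma_coef. pose proof (pow_S_bounds q k Hq).
      assert (0 < / (1 - q ^ S k) <= / (1 - q)).
      { split; [apply Rinv_0_lt_compat | apply Rinv_le_contravar]; lra. }
      assert (0 <= q ^ S k / (1 - q ^ S k) <= / (1 - q)).
      { assert (q ^ S k * / (1 - q ^ S k) <= 1 * / (1 - q ^ S k))
          by (apply Rmult_le_compat_r; lra).
        unfold Rdiv. split; [apply Rmult_le_pos|]; lra. }
      rewrite <- (Rmult_1_l (/ (1 - q))). apply Rmult_le_compat; lra. }
  unfold dirichlet_coef, Rminus.
  eapply Rle_trans; [apply Rabs_triang|]. apply Rplus_le_compat.
  - eapply Rle_trans; [apply Rabs_triang|]. apply Rplus_le_compat.
    + rewrite Rabs_pos_eq; nra.
    + rewrite Rabs_mult, (Rabs_pos_eq (gamma_coef q k)) by lra.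
      apply Rmult_le_compat_l; [apply Rabs_pos | apply Hg].
  - rewrite Rabs_Ropp, Rabs_mult, (Rabs_pos_eq (log_coef k)) by lra.
    pose proof (Rabs_pos (ln q * (alpha + - (1)))). nra.
Qed.

(** With u = - k ln q and w = q^k = e^{-u}, the inequality 1 + u <= e^u reads
    u w <= 1 - w, that is, 1/k >= - ln q * w / (1 - w). *)
Lemma dirichlet_coef_nonneg (q alpha : R) (k : nat) :
  0 < q < 1 -> 1 <= alpha -> 0 <= dirichlet_coef q alpha k.
Proof.
  intros Hq Ha. destruct k as [|k].
  { unfold dirichlet_coef, gamma_coef, log_coef. simpl INR. rewrite Rinv_0. lra. }
  assert (HL : ln q < 0) by (rewrite <- ln_1; apply ln_increasing; lra).
  pose proof (log_coef_bounds (S k)) as Hl.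
  pose proof (pow_S_bounds q k Hq) as Hk.
  assert (Hn : 0 < INR (S k)) by (apply lt_0_INR; lia).
  set (w := q ^ S k) in *.
  assert (Hexp : - ln q * INR (S k) * w <= 1 - w).
  { assert (E : w * exp (- (INR (S k) * ln q)) = 1).
    { unfold w. rewrite <- (Rpower_pow (S k) q) by lra. unfold Rpower.
      rewrite <- exp_plus, <- exp_0. f_equal. ring. }
    pose proof (exp_ineq1_le (- (INR (S k) * ln q))). nra. }
  assert (Hmain : 0 <= log_coef (S k) + ln q * (w / (1 - w))).
  { replace (log_coef (S k) + ln q * (w / (1 - w)))
      with ((1 - w - - ln q * INR (S k) * w) / (INR (S k) * (1 - w)))
      by (unfold log_coef; field; lra).
    apply Rle_div_r; [nra | lra]. }
  replace (dirichlet_coef q alpha (S k))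
    with (log_coef (S k) * (log_coef (S k) + ln q * (w / (1 - w)))
          + - ln q * (alpha - 1) * log_coef (S k))
    by (unfold dirichlet_coef, gamma_coef, w; ring).
  apply Rplus_le_le_0_compat; repeat apply Rmult_le_pos; lra.
Qed.

Lemma PSeries_theta_dirichlet_coef (q alpha y : R) :
  0 < q < 1 -> Rabs y < 1 ->
  PSeries (theta (dirichlet_coef q alpha)) y =
  - ln (1 - y) + ln q * PSeries (theta (gamma_coef q)) y
  - ln q * (alpha - 1) * (y / (1 - y)).
Proof.
  intros Hq Hy.
  assert (H1 : 1 < / q) by (rewrite <- Rinv_1; apply Rinv_lt_contravar; lra).
  assert (El : ex_series (fun k => log_coef k * y ^ k)).
  { now apply ex_series_Rabs, CV_disk_inside, CV_radius_log_coef. }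
  assert (Etl : ex_series (fun k => theta log_coef k * y ^ k)).
  { apply ex_series_Rabs, CV_disk_inside. rewrite CV_radius_theta.
    now apply CV_radius_log_coef. }
  assert (Etg : ex_series (fun k => theta (gamma_coef q) k * y ^ k)).
  { apply ex_series_Rabs, CV_disk_inside. rewrite CV_radius_theta.
    apply CV_radius_gamma_coef; lra. }
  rewrite <- PSeries_log_coef, <- PSeries_theta_log_coef by exact Hy.
  unfold PSeries. rewrite <- !Series_scal_l.
  rewrite <- Series_plus, <- Series_minus;
    try apply (@ex_series_plus R_AbsRing R_NormedModule);
    try apply (@ex_series_scal_l R_AbsRing); try assumption.
  apply Series_ext. intros [|k].
  - unfold theta, dirichlet_coef, gamma_coef, log_coef. simpl INR.
    rewrite Rinv_0. ring.
  - unfold theta, dirichlet_coef, log_coef. field. apply not_0_INR; lia.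
Qed.

(** The derivatives of the dilogarithm term and of the power with exponent
    x + 1 - alpha each contain a multiple of x y / (1 - y), y = q^x; these
    cancel, which leaves a function of q^x alone. *)
Lemma is_derive_ln_inv_f_alpha1 (q alpha x : R) :
  0 < q < 1 -> 0 < x ->
  is_derive (fun x => ln (/ f_alpha1 q alpha x)) x
    (- PSeries (theta (dirichlet_coef q alpha)) (Rpower q x)).
Proof.
  intros Hq Hx. pose proof (Rpower_lt_1 q x Hq Hx) as Hp.
  assert (HL : ln q < 0) by (rewrite <- ln_1; apply ln_increasing; lra).
  assert (H1 : 1 < / q) by (rewrite <- Rinv_1; apply Rinv_lt_contravar; lra).
  assert (DP : is_derive (fun x => PSeries (gamma_coef q) (Rpower q x)) x
                 (ln q * PSeries (theta (gamma_coef q)) (Rpower q x))).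
  { apply is_derive_PSeries_Rpower.
    rewrite <- (Rabs_pos_eq (Rpower q x)) by lra.
    apply CV_radius_gamma_coef; [exact Hq|]. rewrite Rabs_pos_eq; lra. }
  assert (DLi := is_derive_Li2_Rpower q x Hq Hx).
  assert (Dln : is_derive (fun x => ln (1 - Rpower q x)) x
                  (- ln q * (Rpower q x / (1 - Rpower q x)))).
  { unfold Rpower in *. auto_derive; [lra | field; lra]. }
  rewrite PSeries_theta_dirichlet_coef by (try rewrite Rabs_pos_eq; lra).
  eapply is_derive_ext_loc with (f := fun x =>
    x * ln (1 - q) - (PSeries (gamma_coef q) (Rpower q x) - PSeries (gamma_coef q) 1)
    + Li2 (1 - Rpower q x) / ln q
    + (x + 1 - alpha) * (ln (1 - Rpower q x) - ln (1 - q))).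
  { apply (locally_interval _ x 0 p_infty); simpl; [exact Hx | exact I|].
    intros y Hy _. symmetry. now apply ln_inv_f_alpha1. }
  (* The three nontrivial summands are made opaque, so that the rest is a
     routine derivative of a polynomial expression in them. *)
  revert DP DLi Dln.
  set (F1 := fun x => PSeries (gamma_coef q) (Rpower q x)).
  set (F2 := fun x => Li2 (1 - Rpower q x)).
  set (F3 := fun x => ln (1 - Rpower q x)).
  intros DP DLi Dln.
  apply (is_derive_ext (fun x =>
    x * ln (1 - q) - (F1 x - PSeries (gamma_coef q) 1) + F2 x / ln q
    + (x + 1 - alpha) * (F3 x - ln (1 - q)))); [reflexivity|].
  auto_derive.
  - repeat split; eexists; eassumption.
  - apply is_derive_unique in DP, DLi, Dln.
    change (Derive F1 x = ln q * PSeries (theta (gamma_coef q)) (Rpower q x)) in DP.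
    change (Derive F2 x = x * ln q ^ 2 * (Rpower q x / (1 - Rpower q x))) in DLi.
    change (Derive F3 x = - ln q * (Rpower q x / (1 - Rpower q x))) in Dln.
    change (fun y : R => F1 y) with F1. change (fun y : R => F2 y) with F2.
    change (fun y : R => F3 y) with F3.
    rewrite DP, DLi, Dln. unfold F3. field. lra.
Qed.

Lemma is_derive_n_ln_inv_f_alpha1 (q alpha : R) (n : nat) :
  0 < q < 1 -> forall x, 0 < x ->
  is_derive_n (fun x => ln (/ f_alpha1 q alpha x)) (S n) x
    (- (ln q ^ n *
        PSeries (Nat.iter (S n) theta (dirichlet_coef q alpha)) (Rpower q x))).
Proof.
  intros Hq. induction n as [|n IH]; intros x Hx.
  - simpl. rewrite Rmult_1_l. now apply is_derive_ln_inv_f_alpha1.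
  - pose proof (Rpower_lt_1 q x Hq Hx) as Hp.
    change (is_derive (Derive_n (fun x => ln (/ f_alpha1 q alpha x)) (S n)) x
      (- (ln q ^ S n *
        PSeries (theta (Nat.iter (S n) theta (dirichlet_coef q alpha))) (Rpower q x)))).
    set (a := Nat.iter (S n) theta (dirichlet_coef q alpha)) in *.
    apply is_derive_ext_loc with
      (fun x => - (ln q ^ n * PSeries a (Rpower q x))).
    { apply (locally_interval _ x 0 p_infty); simpl; [exact Hx | exact I|].
      intros y Hy _. symmetry.
      exact (is_derive_n_unique _ _ _ _ (IH y Hy)). }
    assert (D : is_derive (fun x => PSeries a (Rpower q x)) x
                  (ln q * PSeries (theta a) (Rpower q x))).
    { apply is_derive_PSeries_Rpower. unfold a. rewrite CV_radius_theta_iter.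
      rewrite <- (Rabs_pos_eq (Rpower q x)) by lra.
      apply CV_radius_dirichlet_coef; [exact Hq|]. rewrite Rabs_pos_eq; lra. }
    refine (is_derive_eq _ _ _ _
      (is_derive_opp _ _ _ (is_derive_scal _ _ (ln q ^ n) _ D)) _).
    unfold opp; simpl. ring.
Qed.

(** * Behaviour near x = 0 and the equivalence *)

(** A simple pole at y = 1 dominates a logarithm.  The witness is
    1 - y = s^{-2} with s = 1 + 2 / B: then ln (1 - y) = - 2 ln s >= - 4 / B,
    whereas B * y / (1 - y) = B (s^2 - 1) = 4 + 4 / B. *)
Lemma ln_plus_pole_pos (B : R) :
  0 < B -> exists y, 0 < y < 1 /\ 0 < ln (1 - y) + B * (y / (1 - y)).
Proof.
  intros HB. set (s := 1 + 2 / B).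
  assert (Hs : 1 < s).
  { unfold s. assert (0 < 2 / B) by (apply Rdiv_lt_0_compat; lra). lra. }
  assert (Hi : 0 < / s < 1).
  { split; [apply Rinv_0_lt_compat; lra|].
    rewrite <- Rinv_1. apply Rinv_lt_contravar; lra. }
  exists (1 - / s * / s). split; [nra|].
  replace (1 - (1 - / s * / s)) with (/ s * / s) by ring.
  rewrite ln_mult, ln_Rinv by lra.
  assert (Hln : ln s <= 2 / B).
  { rewrite <- (ln_exp (2 / B)). apply ln_le; [lra|]. apply exp_ineq1_le. }
  replace (B * ((1 - / s * / s) / (/ s * / s))) with (4 + 2 * (2 / B)).
  - lra.
  - replace ((1 - / s * / s) / (/ s * / s)) with (s * s - 1) by (field; lra).
    unfold s. field. lra.
Qed.

Theorem theorem2 (q alpha : R) (hq : 0 < q < 1) :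
  log_completely_monotonic 0 p_infty (fun x => / f_alpha1 q alpha x) <->
  1 <= alpha.
Proof.
  assert (HL : ln q < 0) by (rewrite <- ln_1; apply ln_increasing; lra).
  split.
  - intros Hcm. apply Rnot_lt_le. intros Ha.
    destruct (ln_plus_pole_pos (- ln q * (1 - alpha)) ltac:(nra))
      as [y [Hy Hpos]].
    assert (Hlny : ln y < 0) by (rewrite <- ln_1; apply ln_increasing; lra).
    set (x := ln y / ln q).
    assert (Hx : 0 < x).
    { unfold x. replace (ln y / ln q) with (- ln y / - ln q) by (field; lra).
      apply Rdiv_lt_0_compat; lra. }
    assert (Hxy : Rpower q x = y).
    { unfold Rpower, x. replace (ln y / ln q * ln q) with (ln y) by (field; lra).
      apply exp_ln; lra. }
    assert (H1 : 1 < / q) by (rewrite <- Rinv_1; apply Rinv_lt_contravar; lra).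
    destruct (Hcm x Hx I) as [_ [_ Hsign]].
    specialize (Hsign 1%nat (le_n _)).
    rewrite (is_derive_n_unique _ _ _ _
               (is_derive_n_ln_inv_f_alpha1 q alpha 0 hq x Hx)) in Hsign.
    simpl in Hsign. rewrite Hxy, PSeries_theta_dirichlet_coef in Hsign
      by (try rewrite Rabs_pos_eq; lra).
    (* The q-gamma part only makes the derivative larger, so the pole wins. *)
    assert (Hg : 0 <= PSeries (theta (gamma_coef q)) y).
    { apply PSeries_nonneg; [|lra|].
      - intros k. apply Rmult_le_pos; [apply pos_INR | now apply gamma_coef_nonneg].
      - rewrite CV_radius_theta. apply CV_radius_gamma_coef; [exact hq|].
        rewrite Rabs_pos_eq; lra. }
    nra.
  - intros Ha x Hx _. simpl in Hx.
    pose proof (Rpower_lt_1 q x hq Hx) as Hp.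
    assert (Hd := fun n => is_derive_n_ln_inv_f_alpha1 q alpha n hq x Hx).
    split; [|split].
    + now apply Rinv_0_lt_compat, f_alpha1_pos.
    + intros [|n]; [exact I|]. exists (- (ln q ^ n *
        PSeries (Nat.iter (S n) theta (dirichlet_coef q alpha)) (Rpower q x))).
      exact (Hd n).
    + intros [|n] Hn; [lia|].
      rewrite (is_derive_n_unique _ _ _ _ (Hd n)).
      set (s := PSeries _ _).
      assert (Hs : 0 <= s).
      { apply PSeries_nonneg; [|lra|].
        - apply theta_iter_nonneg. intros k. now apply dirichlet_coef_nonneg.
        - rewrite CV_radius_theta_iter. apply CV_radius_dirichlet_coef; [exact hq|].
          rewrite Rabs_pos_eq; lra. }
      replace ((-1) ^ S n * - (ln q ^ n * s)) with ((- ln q) ^ n * s).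
      * apply Rmult_le_pos; [apply pow_le; lra | exact Hs].
      * replace (- ln q) with (-1 * ln q) by ring.
        rewrite Rpow_mult_distr. simpl. ring.
Qed.
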